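(* Let $\mu$ be a joint distribution of $(X,A,Y)$ with $X\in\mathcal{X}\subseteq\mathbb{R}^d$, $A\in\{0,1\}$, $Y\in\{0,1\}$. Let $g:\mathcal{X}\to\mathcal{Z}$ be a (measurable) feature transformation, $h:\mathcal{Z}\to\{0,1\}$ a (measurable) classifier, and $\widehat{Y}=h(g(X))$. If $\widehat{Y}$ satisfies demographic parity (i.e. $\widehat{Y}$ is independent of $A$), then $$\mathrm{Err}_{\mu_0}(h\circ g)+\mathrm{Err}_{\mu_1}(h\circ g)\;\ge\;\Delta_{\mathrm{BR}}(\mu_0,\mu_1).$$
   Context: For $a\in\{0,1\}$, $\mu_a$ denotes the conditional distribution of $\mu$ given $A=a$ (it is assumed $\Pr(A=a)>0$). For a predictor $f:\mathcal{X}\to\{0,1\}$, $\mathrm{Err}_{\mu_a}(f)=\Pr_{\mu_a}(Y\neq f(X))$. The difference of base rates is $\Delta_{\mathrm{BR}}(\mu_0,\mu_1)=|\mu_0(Y=1)-\mu_1(Y=1)|$. Demographic parity means $\widehat{Y}$ is independent of $A$, equivalently $\mu_0(\widehat{Y}=1)=\mu_1(\widehat{Y}=1)$. *)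

(* Defs.v *)
From HB Require Import structures.
From mathcomp Require Import all_boot all_order all_algebra.
From mathcomp Require Import all_classical all_reals all_analysis.

Set Implicit Arguments.
Unset Strict Implicit.
Unset Printing Implicit Defensive.

Import Order.TTheory GRing.Theory Num.Theory.

Local Open Scope classical_set_scope.
Local Open Scope ereal_scope.

(* A nonempty [X] in R^d, not assumed Borel, with the trace of the Borel
   sigma-algebra of R^d. R^d is [d.-tuple R] with its product sigma-algebra.
   Nonemptiness only provides the point that [measurableType] requires; it holds
   as soon as there is a probability measure on [X]. *)
Definition inputs (R : realType) (d : nat) (X : set (d.-tuple R))
  (X0 : X !=set0) : Type := X.

Section inputs_measurable.
Variables (R : realType) (d : nat) (X : set (d.-tuple R)) (X0 : X !=set0).

HB.instance Definition _ := Choice.copy (inputs X0) (set_type X).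

HB.instance Definition _ := isPointed.Build (inputs X0)
  (SigSub (mem_set (projT2 (cid X0)))).

Definition input_val (x : inputs X0) : d.-tuple R := set_val x.

HB.instance Definition _ :=
  Measurable.copy (inputs X0) (g_sigma_algebra_preimageType input_val).

End inputs_measurable.

(* A sample is ((x, a), y): features, protected attribute, label. *)
Notation sample T := (T * bool * bool)%type.

Section fairness.
Context (disp : measure_display) (T : measurableType disp) (R : realType).

Local Notation sample := (sample T).

Definition feat (w : sample) : T := w.1.1.
Definition attr (w : sample) : bool := w.1.2.
Definition label (w : sample) : bool := w.2.

Lemma measurable_attr (a : bool) : measurable [set w : sample | attr w = a].
Proof.
have m : measurable_fun [set: sample] attr.
  by apply: measurableT_comp; [exact: measurable_snd|exact: measurable_fst].
by rewrite -[X in measurable X]setTI; exact: (m measurableT [set a]).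
Qed.

Variable mu : probability sample R.

(* E |-> mu (E `&` {A = a}) / mu {A = a}; the last argument of [mnormalize] is
   only its value in the degenerate case mu {A = a} = 0. *)
Definition cond_attr (a : bool) : probability sample R :=
  mnormalize (mrestr mu (measurable_attr a)) mu.

Definition Err (nu : probability sample R) (f : T -> bool) : \bar R :=
  nu [set w | label w <> f (feat w)].

Definition base_rate_gap (nu0 nu1 : probability sample R) : \bar R :=
  `| nu0 [set w | label w = true] - nu1 [set w | label w = true] |.

Definition independent (d1 d2 : measure_display) (T1 : measurableType d1)
    (T2 : measurableType d2) (U : sample -> T1) (V : sample -> T2) : Prop :=
  forall B C, measurable B -> measurable C ->
    mu (U @^-1` B `&` V @^-1` C) = mu (U @^-1` B) * mu (V @^-1` C).

Definition demographic_parity (f : T -> bool) : Prop :=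
  independent (f \o feat) attr.

End fairness.

(* Main.v *)
(* For any law of (X, A, Y), the events {Y = 1} and {f X = 1} differ only inside
   the error event, so their probabilities are at most Err f apart. Demographic
   parity gives {f X = 1} the same probability under mu_0 and mu_1, and the
   triangle inequality through that common value concludes. *)
Require Import Defs.
From HB Require Import structures.
From mathcomp Require Import all_boot all_order all_algebra.
From mathcomp Require Import lra.
From mathcomp Require Import all_classical all_reals all_analysis.
Import Order.TTheory GRing.Theory Num.Theory.

Local Open Scope classical_set_scope.
Local Open Scope ereal_scope.

Section fairness_bound.
Context (disp : measure_display) (T : measurableType disp) (R : realType).

Lemma measurable_label_true : measurable [set w : sample T | label w = true].
Proof.
have m : measurable_fun [set: sample T] (@label _ T) by exact: measurable_snd.
by rewrite -[X in measurable X]setTI; exact: (m measurableT [set true]).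
Qed.

Lemma measurable_pred_feat (f : T -> bool) (b : bool) :
  measurable_fun [set: T] f ->
  measurable [set w : sample T | f (feat w) = b].
Proof.
move=> mf; have m : measurable_fun [set: sample T] (f \o @feat _ T).
  apply: measurableT_comp => //.
  by apply: measurableT_comp; exact: measurable_fst.
by rewrite -[X in measurable X]setTI; exact: (m measurableT [set b]).
Qed.

Lemma measurable_error (f : T -> bool) : measurable_fun [set: T] f ->
  measurable [set w : sample T | label w <> f (feat w)].
Proof.
move=> mf.
(* Since both values are Boolean, the error event is the symmetric difference of {Y = 1} and {f X =
   1}, which is built from measurable sets. *)
have -> : [set w : sample T | label w <> f (feat w)] =
    ([set w | label w = true] `\` [set w | f (feat w) = true]) `|`
    ([set w | f (feat w) = true] `\` [set w | label w = true]).
  by apply/seteqP; split=> w /=; case: (label w); case: (f _);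
    intuition congruence.
have mY := measurable_label_true; have mF := measurable_pred_feat f true mf.
by apply: measurableU; exact: measurableD.
Qed.

Lemma label_le_pred_Err (nu : probability (sample T) R) (f : T -> bool) :
  measurable_fun [set: T] f ->
  nu [set w | label w = true] <= nu [set w | f (feat w) = true] + Err nu f.
Proof.
move=> mf; have mY := measurable_label_true.
have mF := measurable_pred_feat f true mf; have mE := measurable_error f mf.
apply: le_trans (measureU2 _ mF mE).
apply: le_measure; rewrite ?inE//; first exact: measurableU.
by move=> w /= ->; case: (f _); [left|right].
Qed.

Lemma pred_le_label_Err (nu : probability (sample T) R) (f : T -> bool) :
  measurable_fun [set: T] f ->
  nu [set w | f (feat w) = true] <= nu [set w | label w = true] + Err nu f.
Proof.
move=> mf; have mY := measurable_label_true.
have mF := measurable_pred_feat f true mf; have mE := measurable_error f mf.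
apply: le_trans (measureU2 _ mY mE).
apply: le_measure; rewrite ?inE//; first exact: measurableU.
by move=> w /= ->; case: (label w); [left|right].
Qed.

(** Positivity rules out the default value of [mnormalize], which leaves the usual quotient. *)
Lemma cond_attrE (mu : probability (sample T) R) (a : bool)
    (U : set (sample T)) :
  0 < mu [set w | attr w = a] ->
  cond_attr mu a U = mu (U `&` [set w | attr w = a]) *
    (fine (mu [set w | attr w = a]))^-1%:E.
Proof.
move=> mu_gt0.
have mT : mrestr mu (measurable_attr a) setT = mu [set w | attr w = a].
  by rewrite /mrestr setTI.
have mu_lty : mu [set w | attr w = a] < +oo.
  by rewrite ltey_eq fin_num_measure//; exact: measurable_attr.
transitivity (mrestr mu (measurable_attr a) U *
  (fine (mrestr mu (measurable_attr a) setT))^-1%:E); last by rewrite mT.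
transitivity (mnormalize (mrestr mu (measurable_attr a)) mu U) => //.
(* The default branch is taken when the total mass is 0 or [+oo]; both tests fail, by [mu_gt0] and
   [mu_lty]. *)
rewrite /mnormalize ifF//.
by apply/negbTE; rewrite negb_or; apply/andP; split;
  [rewrite [X in X == _]mT gt_eqF|rewrite [X in X == _]mT lt_eqF].
Qed.

(** Independence factors the joint probability of {f X = 1} and {A = a}; normalization then cancels
    the factor of {A = a}. *)
Lemma cond_attr_parity (mu : probability (sample T) R) (f : T -> bool)
    (a : bool) :
  0 < mu [set w | attr w = a] -> demographic_parity mu f ->
  cond_attr mu a [set w | f (feat w) = true] = mu [set w | f (feat w) = true].
Proof.
(* Every set of Booleans is measurable by definition, hence the proofs [I]. *)
move=> mu_gt0 /(_ [set true] [set a] I I) indep.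
have mu_fin : mu [set w | attr w = a] \is a fin_num.
  by apply: fin_num_measure; exact: measurable_attr.
rewrite cond_attrE// [X in X * _]indep -muleA.
rewrite -[X in _ * (X * _)](fineK mu_fin) -EFinM divff ?mule1//.
by rewrite gt_eqF// fine_gt0// mu_gt0 ltey_eq mu_fin.
Qed.

(** The two laws are arbitrary: all that is kept of demographic parity is their common rate of
    positive predictions. *)
Lemma base_rate_gap_le_Err (nu0 nu1 : probability (sample T) R)
    (f : T -> bool) :
  measurable_fun [set: T] f ->
  nu0 [set w | f (feat w) = true] = nu1 [set w | f (feat w) = true] ->
  base_rate_gap nu0 nu1 <= Err nu0 f + Err nu1 f.
Proof.
move=> mf parity; have mY := measurable_label_true.
have mF := measurable_pred_feat f true mf; have mE := measurable_error f mf.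
have := label_le_pred_Err nu0 f mf; have := pred_le_label_Err nu0 f mf.
have := label_le_pred_Err nu1 f mf; have := pred_le_label_Err nu1 f mf.
rewrite /base_rate_gap parity /Err.
(* All five remaining probabilities are finite, so the four inequalities become linear ones over the
   reals. *)
have /fineK <- := fin_num_measure nu0 _ mY.
have /fineK <- := fin_num_measure nu1 _ mY.
have /fineK <- := fin_num_measure nu0 _ mE.
have /fineK <- := fin_num_measure nu1 _ mE.
have /fineK <- := fin_num_measure nu1 _ mF.
rewrite -EFinB abse_EFin -!EFinD !lee_fin => *.
(* Each side of the absolute value chains one upper and one lower bound through the common rate
   [nu1] {f X = 1}. *)
by rewrite ler_norml; apply/andP; split; lra.
Qed.

End fairness_bound.

Theorem theorem8 (R : realType) (d : nat) (X : set (d.-tuple R))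
  (X0 : X !=set0)
  (mu : probability (sample (inputs X0)) R)
  (hA : forall a : bool, 0 < mu [set w | attr w = a])
  (dZ : measure_display) (Z : measurableType dZ)
  (g : inputs X0 -> Z) (h : Z -> bool)
  (mg : measurable_fun [set: inputs X0] g)
  (mh : measurable_fun [set: Z] h)
  (hDP : demographic_parity mu (h \o g)) :
  base_rate_gap (cond_attr mu false) (cond_attr mu true) <=
    Err (cond_attr mu false) (h \o g) + Err (cond_attr mu true) (h \o g).
Proof.
apply: base_rate_gap_le_Err; first exact: measurableT_comp.
by rewrite !cond_attr_parity.
Qed.
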